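(* Let $\mathcal{P}=(\mathcal{R},\mathcal{I})$ be an asynchronous program, let $Q[1],\ldots,Q[m]$ be predicates over $S$, $L$ and $L_P$, and let $\#_{IT}$ be the number of inter-thread predicates among $Q[1],\ldots,Q[m]$. Then the sequence of template programs $\tilde{\mathcal{P}}(n)=(\tilde{\mathcal{R}}(n),\tilde{\mathcal{I}}(n))$, $n\ge 2$, stabilizes at $\mathsf{b}=4\cdot\#_{IT}+2$; that is, for all $n\ge \mathsf{b}$, $\tilde{\mathcal{P}}(n)=\tilde{\mathcal{P}}(\mathsf{b})$.
   Context: **Asynchronous programs.** An asynchronous program $\mathcal{P}=(\mathcal{R},\mathcal{I})$ has a variable set $V=S\uplus L$ ($S$: shared variables, $L$: local variables), a transition formula $\mathcal{R}$ over $V\cup V'$ (unprimed = current-state, primed = next-state) and an initial formula $\mathcal{I}$ over $V$. For each index $i$ let $L_i=\{l_i : l\in L\}$ be the copy of the local variables owned by thread $i$, and let $V_n=S\cup L_1\cup\dots\cup L_n$. For a formula $f$, $f\{X_1\triangleright X_2\}$ denotes $f$ with every variable of $X_1$ replaced by the variable of $X_2$ with the same base name, and $f\{X_1\triangleright\triangleright X_2\}$ denotes the same replacement applied to both unprimed and primed variables. The $n$-thread instantiation is $\mathcal{P}^n=(\mathcal{R}^n,\mathcal{I}^n)$ with $\mathcal{R}^n=\bigvee_{a=1}^n(\mathcal{R}_a)^n$, $(\mathcal{R}_a)^n := \mathcal{R}\{L\triangleright\triangleright L_a\}\wedge\bigwedge_{p\in\{1,\dots,n\},\,p\neq a}\bigwedge_{l\in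 L} l_p=l_p'$, and $\mathcal{I}^n=\bigwedge_{a=1}^n\mathcal{I}\{L\triangleright L_a\}$. **Predicates.** $L_P=\{l_P : l\in L\}$ is a set of passive-thread variables. A predicate over $S,L,L_P$ is *shared* if it contains variables from $S$ only, *single-thread* if it contains variables from $L$ but not from $L_P$, and *inter-thread* if it contains variables from $L$ and from $L_P$ (single- and inter-thread predicates may also contain variables from $S$). Every $Q[i]$ belongs to one of these three classes. For $n\ge2$ and active thread $a\in\{1,\dots,n\}$, $Q[i]_a := \bigwedge_{p\neq a} Q[i]\{L\triangleright L_a\}\{L_P\triangleright L_p\}$, with $p$ ranging over $\{1,\dots,n\}$. **Existential abstraction.** For each thread $a$, $\hat L_a=\{b[i]_a : 1\le i\le m\}$ are Boolean variables. Let $\mathcal{D}^n := \bigwedge_{i=1}^m\bigwedge_{a=1}^n (b[i]_a\Leftrightarrow Q[i]_a)$, and let $(\mathcal{D}^n)'$ be $\mathcal{D}^n$ with all variables primed. Define $(\hat{\mathcal{R}}_a)^n := \exists V_n V_n'.\ (\mathcal{R}_a)^n\wedge\mathcal{D}^n\wedge(\mathcal{D}^n)'$ and $\hat{\mathcal{I}}^n := \exists V_n.\ \mathcal{I}^n\wedge\mathcal{D}^n$. **Template programs.** Let $\tilde L=\{b[i] : 1\le i\le m\}$ and $\tilde L_P=\{b[i]_P : 1\le i\le m\}$. For $n\ge 2$, $\tilde{\mathcal{P}}(n)=(\tilde{\mathcal{R}}(n),\tilde{\mathcal{I}}(n))$ is given by $$\tilde{\mathcal{R}}(n) := \exists \hat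 L_3,\hat L_3',\ldots,\hat L_n,\hat L_n'.\ (\hat{\mathcal{R}}_1)^n\{\hat L_1\triangleright\triangleright\tilde L\}\{\hat L_2\triangleright\triangleright\tilde L_P\},$$ $$\tilde{\mathcal{I}}(n) := \exists \hat L_3,\ldots,\hat L_n.\ \hat{\mathcal{I}}^n\{\hat L_1\triangleright\tilde L\}\{\hat L_2\triangleright\tilde L_P\}.$$ Equality of such programs means logical equivalence of the respective (Boolean) formulas. *)

(* Defs.v *)
From HB Require Import structures.
From mathcomp Require Import all_boot.
From mathcomp Require Import boolp classical_sets.

Set Implicit Arguments.
Unset Strict Implicit.
Unset Printing Implicit Defensive.

Local Open Scope classical_set_scope.

(** Ownership tag of a local or Boolean variable: [Bare] tags the untagged
    variables of L and L~, [Passive] those of L_P and L~_P, and [Thread a]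
    those of L_a and L^_a, with threads numbered from 1. *)
Inductive owner := Bare | Passive | Thread of nat.

Definition owner_code (o : owner) : option (option nat) :=
  match o with
  | Bare => None | Passive => Some None | Thread a => Some (Some a)
  end.

Definition owner_decode (c : option (option nat)) : owner :=
  match c with
  | None => Bare | Some None => Passive | Some (Some a) => Thread a
  end.

Lemma owner_codeK : cancel owner_code owner_decode. Proof. by case. Qed.

HB.instance Definition _ := Equality.copy owner (can_type owner_codeK).

Section Formulas.

(** [S] and [L] are the base names of the shared and local variables; each
    variable has its own sort. *)
Variables (S L : Type) (DS : S -> Type) (DL : L -> Type).

(** The last Boolean of each constructor is [true] for primed variables;
    [BVar i o p] is the predicate variable b[i]. *)
Inductive var :=
  | Shared of S & bool
  | Local of L & owner & bool
  | BVar of nat & owner & bool.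

Definition var_sort (x : var) : Type :=
  match x with Shared s _ => DS s | Local l _ _ => DL l | BVar _ _ _ => bool end.

Definition valuation := forall x : var, var_sort x.

(** No particular logic is fixed: a formula is its set of (free) variables,
    which may be larger than the set of variables its truth value depends on,
    together with its satisfaction relation, subject to the coincidence
    property. *)
Record formula := Formula {
  vars : set var;
  sat : valuation -> Prop;
  coincidence : forall v w : valuation,
    (forall x, vars x -> v x = w x) -> sat v <-> sat w }.

Definition equivalent (f g : formula) := forall v, sat f v <-> sat g v.

Lemma fand_subproof f g (v w : valuation) :
  (forall x, (vars f `|` vars g) x -> v x = w x) ->
  (sat f v /\ sat g v) <-> (sat f w /\ sat g w).
Proof.
move=> vw; rewrite (coincidence (f := f) (w := w)); last by move=> x ?; apply: vw; left.
by rewrite (coincidence (f := g) (w := w)) // => x ?; apply: vw; right.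
Qed.
Definition fand f g := Formula (@fand_subproof f g).

Lemma fiff_subproof f g (v w : valuation) :
  (forall x, (vars f `|` vars g) x -> v x = w x) ->
  (sat f v <-> sat g v) <-> (sat f w <-> sat g w).
Proof.
move=> vw; rewrite (coincidence (f := f) (w := w)); last by move=> x ?; apply: vw; left.
by rewrite (coincidence (f := g) (w := w)) // => x ?; apply: vw; right.
Qed.
Definition fiff f g := Formula (@fiff_subproof f g).

Lemma fbigand_subproof I (P : set I) (F : I -> formula) (v w : valuation) :
  (forall x, (\bigcup_(i in P) vars (F i)) x -> v x = w x) ->
  (forall i, P i -> sat (F i) v) <-> (forall i, P i -> sat (F i) w).
Proof.
move=> vw; split=> h i Pi; apply: (iffLR (coincidence _)) (h i Pi) => x Fx.
  by apply: vw; exists i.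
by symmetry; apply: vw; exists i.
Qed.
Definition fbigand I (P : set I) (F : I -> formula) :=
  Formula (@fbigand_subproof I P F).

Lemma funchanged_subproof l p (v w : valuation) :
  (forall x, [set Local l (Thread p) false; Local l (Thread p) true] x ->
     v x = w x) ->
  v (Local l (Thread p) false) = v (Local l (Thread p) true) <->
  w (Local l (Thread p) false) = w (Local l (Thread p) true).
Proof. by move=> vw; rewrite !vw //; [right|left]. Qed.
Definition funchanged l p := Formula (@funchanged_subproof l p).

Lemma fbvar_subproof i a (v w : valuation) :
  (forall x, [set BVar i (Thread a) false] x -> v x = w x) ->
  (v (BVar i (Thread a) false) : Prop) <-> (w (BVar i (Thread a) false) : Prop).
Proof. by move=> vw; rewrite vw. Qed.
Definition fbvar i a := Formula (@fbvar_subproof i a).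

Lemma fexists_subproof (X : set var) f (v w : valuation) :
  (forall x, (vars f `\` X) x -> v x = w x) ->
  (exists u : valuation, (forall x, ~ X x -> u x = v x) /\ sat f u) <->
  (exists u : valuation, (forall x, ~ X x -> u x = w x) /\ sat f u).
Proof.
have H (v1 v2 : valuation) : (forall x, (vars f `\` X) x -> v1 x = v2 x) ->
    (exists u : valuation, (forall x, ~ X x -> u x = v1 x) /\ sat f u) ->
    (exists u : valuation, (forall x, ~ X x -> u x = v2 x) /\ sat f u).
  move=> vw [u [uv fu]].
  exists (fun x => if pselect (X x) then u x else v2 x); split.
    by move=> x; case: pselect.
  apply: (iffLR (coincidence _)) fu => x fx; case: pselect => // nX.
  by rewrite -vw// uv.
by move=> vw; split; apply: H => // x /vw.
Qed.
Definition fexists (X : set var) f := Formula (@fexists_subproof X f).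

(** A renaming preserves base names, hence sorts, and changes only ownership
    tags and primes. *)
Record renaming := Renaming {
  renS : bool -> bool;
  renL : owner -> bool -> owner * bool;
  renB : owner -> bool -> owner * bool }.

Definition ren_var (r : renaming) (x : var) : var :=
  match x with
  | Shared s p => Shared s (renS r p)
  | Local l o p => let: (o', p') := renL r o p in Local l o' p'
  | BVar i o p => let: (o', p') := renB r o p in BVar i o' p'
  end.

(** The value of [x] under [ren_val r v] is that of [ren_var r x] under [v];
    the match is only there for typing. *)
Definition ren_val (r : renaming) (v : valuation) : valuation := fun x =>
  match x return var_sort x with
  | Shared s p => v (Shared s (renS r p))
  | Local l o p => let: (o', p') := renL r o p in v (Local l o' p')
  | BVar i o p => let: (o', p') := renB r o p in v (BVar i o' p')
  end.

Lemma frename_subproof r f (v w : valuation) :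
  (forall x, (ren_var r @` vars f) x -> v x = w x) ->
  sat f (ren_val r v) <-> sat f (ren_val r w).
Proof.
move=> vw; apply: coincidence => x fx.
have : (ren_var r @` vars f) (ren_var r x) by exists x.
by case: x {fx} => [s p|l o p|i o p] /=; [|case: renL => ? ?|case: renB => ? ?];
  apply: vw.
Qed.
Definition frename (r : renaming) f := Formula (@frename_subproof r f).

Definition retag (o1 o2 o : owner) := if o == o1 then o2 else o.

(** f{X1 |> X2}, on unprimed variables only, where X1 and X2 are the local
    ([subL]) or Boolean ([subB]) variables tagged [o1] and [o2]. *)
Definition subL (o1 o2 : owner) := frename (Renaming id
  (fun o p => (if p then o else retag o1 o2 o, p)) pair).
Definition subB (o1 o2 : owner) := frename (Renaming id
  pair (fun o p => (if p then o else retag o1 o2 o, p))).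

(** f{X1 |>|> X2}, on both unprimed and primed variables. *)
Definition subLL (o1 o2 : owner) := frename (Renaming id
  (fun o p => (retag o1 o2 o, p)) pair).
Definition subBB (o1 o2 : owner) := frename (Renaming id
  pair (fun o p => (retag o1 o2 o, p))).

Definition fprime := frename (Renaming (fun=> true)
  (fun o _ => (o, true)) (fun o _ => (o, true))).

Definition Svars (p : bool) : set var := range (fun s => Shared s p).
Definition Lvars (o : owner) (p : bool) : set var :=
  range (fun l => Local l o p).
(** Predicates are indexed by 0, ..., m - 1. *)
Definition Bvars (m : nat) (o : owner) (p : bool) : set var :=
  [set BVar i o p | i in [set i | i < m]].

Definition threads (n : nat) : set nat := [set a | 1 <= a <= n].

Definition Vn (n : nat) (p : bool) : set var :=
  Svars p `|` \bigcup_(a in threads n) Lvars (Thread a) p.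

Record program := Program {
  trans : formula;
  init : formula;
  trans_over : vars trans `<=` (Svars false `|` Lvars Bare false)
                               `|` (Svars true `|` Lvars Bare true);
  init_over : vars init `<=` Svars false `|` Lvars Bare false }.

(** (R_a)^n *)
Definition trans_thread (P : program) (n a : nat) : formula :=
  fand (subLL Bare (Thread a) (trans P))
       (fbigand [set p | threads n p /\ p <> a]
          (fun p => fbigand [set: L] (fun l => funchanged l p))).

(** I^n *)
Definition init_inst (P : program) (n : nat) : formula :=
  fbigand (threads n) (fun a => subL Bare (Thread a) (init P)).

Definition predicate_over (f : formula) :=
  vars f `<=` Svars false `|` Lvars Bare false `|` Lvars Passive false.

Definition shared_pred (f : formula) := vars f `<=` Svars false.
Definition single_thread (f : formula) :=
  vars f `&` Lvars Bare false !=set0 /\ vars f `&` Lvars Passive false = set0.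
Definition inter_thread (f : formula) :=
  vars f `&` Lvars Bare false !=set0 /\ vars f `&` Lvars Passive false !=set0.

Definition count_inter_thread (m : nat) (Q : 'I_m -> formula) : nat :=
  #|[pred i | `[< inter_thread (Q i) >]]|.

(** Q_a for n threads. *)
Definition pred_inst (n a : nat) (Q : formula) : formula :=
  fbigand [set p | threads n p /\ p <> a]
    (fun p => subL Passive (Thread p) (subL Bare (Thread a) Q)).

(** D^n *)
Definition abs_map (m : nat) (Q : 'I_m -> formula) (n : nat) : formula :=
  fbigand [set: 'I_m] (fun i => fbigand (threads n) (fun a =>
    fiff (fbvar i a) (pred_inst n a (Q i)))).

(** (R^_a)^n and I^^n *)
Definition abs_trans (P : program) m (Q : 'I_m -> formula) (n a : nat) :=
  fexists (Vn n false `|` Vn n true)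
    (fand (fand (trans_thread P n a) (abs_map Q n)) (fprime (abs_map Q n))).
Definition abs_init (P : program) m (Q : 'I_m -> formula) (n : nat) :=
  fexists (Vn n false) (fand (init_inst P n) (abs_map Q n)).

Record template := Template { ttrans : formula; tinit : formula }.

Definition template_eq (T1 T2 : template) :=
  equivalent (ttrans T1) (ttrans T2) /\ equivalent (tinit T1) (tinit T2).

(** P~(n), meaningful for n >= 2. *)
Definition template_of (P : program) m (Q : 'I_m -> formula) (n : nat) :=
  Template
    (fexists (\bigcup_(a in [set a | 3 <= a <= n])
                (Bvars m (Thread a) false `|` Bvars m (Thread a) true))
       (subBB (Thread 2) Passive (subBB (Thread 1) Bare (abs_trans P Q n 1))))
    (fexists (\bigcup_(a in [set a | 3 <= a <= n]) Bvars m (Thread a) false)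
       (subB (Thread 2) Passive (subB (Thread 1) Bare (abs_init P Q n)))).

End Formulas.

(* Main.v *)
(** Only the values of the predicates at threads 1 and 2 are visible in P~(n).
    Pulling the local states back along a map pi from the threads {1..k} to the
    threads {1..n} that fixes 1 and 2 therefore turns a witness for P~(n) into
    one for P~(k), provided that pi sends only thread 1 to thread 1 (the others
    must stay idle) and preserves the truth of the inter-thread predicates at
    threads 1 and 2; the others do not depend on the passive thread. From b to
    n >= b threads, let pi duplicate the last thread: if there are inter-thread
    predicates then b >= 6, so this is neither thread 1 nor thread 2. From n to
    b threads, let pi enumerate one falsifying passive thread for each
    inter-thread predicate, each of the active threads 1 and 2, and each of the
    current and next states: these are the 4 #IT threads besides 1 and 2. *)

Require Import Defs.
From mathcomp Require Import all_boot.
From mathcomp Require Import boolp classical_sets.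

Set Implicit Arguments.
Unset Strict Implicit.
Unset Printing Implicit Defensive.

Local Open Scope classical_set_scope.

Section Templates.
Variables (S L : Type) (DS : S -> Type) (DL : L -> Type).
Notation formula := (formula DS DL).
Notation valuation := (valuation DS DL).
Implicit Types (f : formula) (v w : valuation) (t : bool).

(** * Predicate instances at an active and a passive thread *)

Definition timed t f := if t then fprime f else f.

Definition pair_inst (a q : nat) f :=
  subL Passive (Thread q) (subL Bare (Thread a) f).

Lemma sat_pred_inst t n a f w : sat (timed t (pred_inst n a f)) w <->
  forall q, threads n q -> q <> a -> sat (timed t (pair_inst a q f)) w.
Proof. by case: t; split=> h q; [move=> ? ?|case|move=> ? ?|case]; apply: h. Qed.

Lemma sat_pair_passive_free t a q q' f w : predicate_over f ->
  vars f `&` @Lvars S L Passive false = set0 ->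
  sat (timed t (pair_inst a q f)) w -> sat (timed t (pair_inst a q' f)) w.
Proof.
move=> f_over f_passive.
case: t => /=; apply: (iffLR (coincidence _)) => x fx;
  case: (f_over _ fx) => [[[s _ <-]|[l _ <-]]|xP] //;
  by have : (vars f `&` @Lvars S L Passive false) x by []; rewrite f_passive.
Qed.

(** * Pulling local states back along a map of threads *)

Definition reindex (pi : nat -> nat) := Renaming id
  (fun o t => (if o is Thread a then Thread (pi a) else o, t)) pair.

(** A predicate has no thread-tagged variables of its own, so the only tags that [pi] can move are
    the [a] and [q] introduced by the instantiation. *)
Lemma sat_pair_reindex t pi a q f w : predicate_over f ->
  sat (timed t (pair_inst a q f)) (ren_val (reindex pi) w) <->
  sat (timed t (pair_inst (pi a) (pi q) f)) w.
Proof.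
move=> f_over; case: t => /=; apply: coincidence => x /f_over;
  by case=> [[[s _ <-]|[l _ <-]]|[l _ <-]].
Qed.

(** Thread 1 makes the same step because [pi 1 = 1]. Every other thread [p] copies thread [pi p],
    which is idle because it is not thread 1. *)
Lemma sat_trans_reindex (P : program DS DL) n k pi w :
  pi 1 = 1 -> (forall p, threads k p -> threads n (pi p)) ->
  (forall p, threads k p -> p <> 1 -> pi p <> 1) ->
  sat (trans_thread P n 1) w -> sat (trans_thread P k 1) (ren_val (reindex pi) w).
Proof.
move=> pi1 pin pi_neq1 [Pw w_idle]; split.
  move: Pw => /=; apply: (iffLR (coincidence _)) => x /trans_over.
  by case=> [[[s _ <-]|[l _ <-]]|[[s _ <-]|[l _ <-]]] //=; rewrite pi1.
by move=> p [kp p1] l _ /=; apply: (w_idle (pi p)) => //; split; auto.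
Qed.

Lemma sat_init_reindex (P : program DS DL) n k pi w :
  (forall p, threads k p -> threads n (pi p)) ->
  sat (init_inst P n) w -> sat (init_inst P k) (ren_val (reindex pi) w).
Proof.
move=> pin Iw p kp; move: (Iw _ (pin _ kp)) => /=.
by apply: (iffLR (coincidence _)) => x /init_over [[s _ <-]|[l _ <-]].
Qed.

Lemma vars_trans_thread (P : program DS DL) n a : threads n a ->
  vars (trans_thread P n a) `<=` Vn n false `|` Vn n true.
Proof.
move=> na x [[y /trans_over + <-]|[p [np _] [l _ [->|->]]]].
- case=> [[[s _ <-]|[l _ <-]]|[[s _ <-]|[l _ <-]]].
  + by left; left; exists s.
  + by left; right; exists a => //; exists l.
  + by right; left; exists s.
  + by right; right; exists a => //; exists l.
- by left; right; exists p => //; exists l.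
- by right; right; exists p => //; exists l.
Qed.

Lemma vars_init_inst (P : program DS DL) n :
  vars (init_inst P n) `<=` Vn n false.
Proof.
move=> x [a na [y /init_over + <-]] => -[[s _ <-]|[l _ <-]].
  by left; exists s.
by right; exists a => //; exists l.
Qed.

Lemma vars_pred_inst t n a f : threads n a -> predicate_over f ->
  vars (timed t (pred_inst n a f)) `<=` Vn n t.
Proof.
move=> na f_over.
have H : vars (pred_inst n a f) `<=` Vn n false.
  move=> _ [p [np _] [_ [y /f_over + <-] <-]].
  case=> [[[s _ <-]|[l _ <-]]|[l _ <-]].
  - by left; exists s.
  - by right; exists a => //; exists l.
  - by right; exists p => //; exists l.
case: t => //= _ [x /H + <-] => -[[s _ <-]|[b nb [l _ <-]]].
  by left; exists s.
by right; exists b => //; exists l.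
Qed.

Lemma Vn_BVar n t i o u : ~ @Vn S L n t (BVar S L i o u).
Proof. by case=> [[]|[? _ []]]. Qed.

(** The shape of a witness for [fexists X]: free on [X], equal to [v] elsewhere. *)
Definition override (X : set (var S L)) w v : valuation :=
  fun x => if pselect (X x) then w x else v x.

Lemma override_in X w v x : X x -> override X w v x = w x.
Proof. by rewrite /override; case: pselect. Qed.

Lemma override_out X w v x : ~ X x -> override X w v x = v x.
Proof. by rewrite /override; case: pselect. Qed.

Lemma sat_override X w v f : vars f `<=` X -> sat f (override X w v) <-> sat f w.
Proof. by move=> fX; apply: coincidence => x /fX; apply: override_in. Qed.

(** * Abstractions and templates in terms of concrete states *)

Section Abstraction.
Variables (P : program DS DL) (m : nat) (Q : 'I_m -> formula).
Hypothesis Q_over : forall i, predicate_over (Q i).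

(** The Boolean values are a separate argument, so that they can come from another valuation than
    the concrete states in [w]. *)
Definition abstracts n t w (beta : 'I_m -> nat -> bool) :=
  forall i a, threads n a -> beta i a <-> sat (timed t (pred_inst n a (Q i))) w.

Lemma sat_abs_map n w : sat (abs_map Q n) w <->
  abstracts n false w (fun i a => w (BVar S L i (Thread a) false)).
Proof. by split=> h i => [|_] a na; apply: h. Qed.

Lemma sat_abs_map_prime n w : sat (fprime (abs_map Q n)) w <->
  abstracts n true w (fun i a => w (BVar S L i (Thread a) true)).
Proof. by split=> h i => [|_] a na; apply: h. Qed.

(** Only concrete variables are quantified, so the Booleans are read in [v]. The matrix has all its
    concrete variables in the quantified set, so [w] need not agree with [v] anywhere. *)
Lemma sat_abs_trans n a v : threads n a ->
  sat (abs_trans P Q n a) v <->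
  exists2 w, sat (trans_thread P n a) w &
    forall t, abstracts n t w (fun i b => v (BVar S L i (Thread b) t)).
Proof.
move=> na; split.
  case=> w [wv [[Pw /sat_abs_map Dw] /sat_abs_map_prime Dw']].
  have wvB i b t : v (BVar S L i (Thread b) t) = w (BVar S L i (Thread b) t).
    by rewrite wv // => -[] /Vn_BVar.
  by exists w => // -[] i b nb; rewrite wvB; [apply: Dw'|apply: Dw].
case=> w Pw Dw; set X := @Vn S L n false `|` @Vn S L n true.
have oB i b t : override X w v (BVar S L i (Thread b) t) = v (BVar S L i (Thread b) t).
  by rewrite override_out // => -[] /Vn_BVar.
exists (override X w v); split; first by move=> x; apply: override_out.
split; first split.
- by apply/sat_override => //; apply: vars_trans_thread.
- apply/sat_abs_map => i b nb; rewrite oB sat_override; first exact: Dw.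
  by move=> x xP; left; exact: (vars_pred_inst (t := false) nb (@Q_over i) xP).
- apply/sat_abs_map_prime => i b nb; rewrite oB sat_override; first exact: Dw.
  by move=> x xP; right; exact: (vars_pred_inst (t := true) nb (@Q_over i) xP).
Qed.

Lemma sat_abs_init n v :
  sat (abs_init P Q n) v <->
  exists2 w, sat (init_inst P n) w &
    abstracts n false w (fun i b => v (BVar S L i (Thread b) false)).
Proof.
split.
  case=> w [wv [Pw /sat_abs_map Dw]].
  by exists w => // i b nb; rewrite -wv; [apply: Dw|move=> /Vn_BVar].
case=> w Pw Dw; exists (override (Vn n false) w v).
split; first by move=> x; apply: override_out.
split; first by apply/sat_override => //; apply: vars_init_inst.
apply/sat_abs_map => i b nb; rewrite override_out; last by move=> /Vn_BVar.
by rewrite sat_override; [apply: Dw|apply: (vars_pred_inst (t := false) nb (@Q_over i))].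
Qed.

Definition template_abstracts n t w v := forall i : 'I_m,
  (v (BVar S L i Bare t) <-> sat (timed t (pred_inst n 1 (Q i))) w) /\
  (v (BVar S L i Passive t) <-> sat (timed t (pred_inst n 2 (Q i))) w).

(** Witnesses for the quantified variables b[i]_a of threads a >= 3: they are
    determined by the concrete states in [w]. *)
Definition bvar_truth n w v : valuation := fun x =>
  match x return var_sort DS DL x with
  | Shared s t => v (Shared L s t)
  | Local l o t => v (Local S l o t)
  | BVar i o t =>
    if o is Thread a then
      if insub i is Some j then `[< sat (timed t (pred_inst n a (Q j))) w >]
      else v (BVar S L i o t)
    else v (BVar S L i o t)
  end.

Lemma threads_split n a : threads n a -> [\/ a = 1, a = 2 | 3 <= a <= n].
Proof.
rewrite /threads /=; case: a => [|[|[|a]]] // na;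
  by [apply: Or31|apply: Or32|apply: Or33].
Qed.

Lemma retag_thread k o a : a != k -> retag (Thread k) o (Thread a) = Thread a.
Proof. by move=> a_neqk; rewrite /retag; case: eqP => // -[E]; rewrite E eqxx in a_neqk. Qed.

Lemma bvar_truthE n w v (i : 'I_m) a t :
  bvar_truth n w v (BVar S L i (Thread a) t)
  = `[< sat (timed t (pred_inst n a (Q i))) w >].
Proof. by rewrite /= valK. Qed.

(** The renamings tie the Booleans of threads 1 and 2 to those tagged [Bare] and [Passive]. Those of
    the other threads are quantified and impose nothing on [w], since [bvar_truth] always provides
    them. *)
Lemma sat_ttrans n v : 2 <= n ->
  sat (ttrans (template_of P Q n)) v <->
  exists2 w, sat (trans_thread P n 1) w & forall t, template_abstracts n t w v.
Proof.
move=> n2; have n1 : threads n 1 by rewrite /threads /= ltnW.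
have n2' : threads n 2 by [].
set X := \bigcup_(a in [set a | 3 <= a <= n])
  (@Bvars S L m (Thread a) false `|` @Bvars S L m (Thread a) true).
have XB i o t : (forall a, o = Thread a -> ~~ (3 <= a)) -> ~ X (BVar S L i o t).
  move=> oa [a /andP[a3 _] [[j _ [_ E _]]|[j _ [_ E _]]]];
  by have := oa a (esym E); rewrite a3.
split.
  case=> u [uv /(sat_abs_trans _ n1)[w Pw Dw]]; exists w => // t i.
  split; [have := Dw t i 1 n1|have := Dw t i 2 n2'];
    by rewrite /= /retag /= uv //; apply: XB.
case=> w Pw Dw; exists (override X (bvar_truth n w v) v).
split; first by move=> x; apply: override_out.
apply/(sat_abs_trans _ n1); exists w => // t i a na /=.
have [->|->|a3] := threads_split na.
- by rewrite /retag /= override_out; [apply: (Dw t i).1|apply: XB].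
- by rewrite /retag /= override_out; [apply: (Dw t i).2|apply: XB].
have [a1 a2] : a != 1 /\ a != 2 by case: a a3 {na} => [|[|[|a]]].
rewrite (retag_thread _ a1) (retag_thread _ a2).
rewrite override_in; last by exists a => //; case: t; [right|left]; exists i => /=.
by rewrite bvar_truthE; split=> /asboolP.
Qed.

Lemma sat_tinit n v : 2 <= n ->
  sat (tinit (template_of P Q n)) v <->
  exists2 w, sat (init_inst P n) w & template_abstracts n false w v.
Proof.
move=> n2; have n1 : threads n 1 by rewrite /threads /= ltnW.
have n2' : threads n 2 by [].
set X := \bigcup_(a in [set a | 3 <= a <= n]) @Bvars S L m (Thread a) false.
have XB i o : (forall a, o = Thread a -> ~~ (3 <= a)) -> ~ X (BVar S L i o false).
  move=> oa [a /andP[a3 _] [j _ [_ E]]].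
  by have := oa a (esym E); rewrite a3.
split.
  case=> u [uv /sat_abs_init[w Pw Dw]]; exists w => // i.
  split; [have := Dw i 1 n1|have := Dw i 2 n2'];
    by rewrite /= /retag /= uv //; apply: XB.
case=> w Pw Dw; exists (override X (bvar_truth n w v) v).
split; first by move=> x; apply: override_out.
apply/sat_abs_init; exists w => // i a na /=.
have [->|->|a3] := threads_split na.
- by rewrite /retag /= override_out; [apply: (Dw i).1|apply: XB].
- by rewrite /retag /= override_out; [apply: (Dw i).2|apply: XB].
have [a1 a2] : a != 1 /\ a != 2 by case: a a3 {na} => [|[|[|a]]].
rewrite (retag_thread _ a1) (retag_thread _ a2).
rewrite override_in; last by exists a => //; exists i => /=.
by rewrite (bvar_truthE _ _ _ _ _ false); split=> /asboolP.
Qed.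

(** * Reindexings that preserve the visible predicates *)

Hypothesis Q_class : forall i,
  shared_pred (Q i) \/ single_thread (Q i) \/ inter_thread (Q i).

Lemma passive_free i : ~ inter_thread (Q i) ->
  vars (Q i) `&` @Lvars S L Passive false = set0.
Proof.
case: (Q_class i) => [sh _|[[_ ->] //|//]].
by rewrite -subset0 => x [/sh [s _ <-] [l _]].
Qed.

(** [e] is the active thread whose values are visible: b[i] for 1, b[i]_P for 2. *)
Definition preserves n k pi t w := forall i e, e = 1 \/ e = 2 ->
  inter_thread (Q i) ->
  (forall q, threads k q -> q <> e ->
     sat (timed t (pair_inst e (pi q) (Q i))) w) <->
  (forall q, threads n q -> q <> e ->
     sat (timed t (pair_inst e q (Q i))) w).

Lemma sat_pred_reindex n k pi t w i e : 2 <= n -> 2 <= k ->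
  e = 1 \/ e = 2 -> pi e = e -> preserves n k pi t w ->
  sat (timed t (pred_inst k e (Q i))) (ren_val (reindex pi) w) <->
  sat (timed t (pred_inst n e (Q i))) w.
Proof.
move=> n2 k2 e12 pie pres; rewrite !sat_pred_inst.
have -> : (forall q, threads k q -> q <> e -> sat (timed t (pair_inst e q (Q i)))
             (ren_val (reindex pi) w)) <->
          (forall q, threads k q -> q <> e ->
             sat (timed t (pair_inst e (pi q) (Q i))) w).
  by split=> h q kq qe; move: (h q kq qe); rewrite sat_pair_reindex // pie.
have [it|/passive_free nit] := pselect (inter_thread (Q i)); first exact: pres.
(* [3 - e] is the other one of threads 1 and 2, so neither conjunction over passive threads is
   empty, and one instance of a predicate free of passive variables yields all others. *)
have other N : 2 <= N -> threads N (3 - e) /\ 3 - e <> e.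
  by case: e12 => -> N2; split=> //; rewrite /threads /= ?N2 // ltnW.
split=> h q _ _; [have [+ +] := other k k2|have [+ +] := other n n2];
  by move=> /h /[apply]; apply: sat_pair_passive_free.
Qed.

(** One [pi] serves both values of [t], as a transition relates the current and next states; it may
    depend on [w]. *)
Definition simulating n k w pi :=
  [/\ pi 1 = 1, pi 2 = 2, forall p, threads k p -> threads n (pi p),
      forall p, threads k p -> p <> 1 -> pi p <> 1 &
      forall t, preserves n k pi t w].

Lemma template_abstracts_reindex n k pi t w v : 2 <= n -> 2 <= k ->
  pi 1 = 1 -> pi 2 = 2 -> preserves n k pi t w ->
  template_abstracts n t w v ->
  template_abstracts k t (ren_val (reindex pi) w) v.
Proof.
move=> n2 k2 pi1 pi2 pres Dw i; have [D1 D2] := Dw i.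
have e1 := sat_pred_reindex i n2 k2 (or_introl erefl) pi1 pres.
have e2 := sat_pred_reindex i n2 k2 (or_intror erefl) pi2 pres.
by split; [rewrite e1|rewrite e2].
Qed.

Lemma template_sub n k : 2 <= n -> 2 <= k ->
  (forall w, exists pi, simulating n k w pi) -> forall v,
  (sat (ttrans (template_of P Q n)) v -> sat (ttrans (template_of P Q k)) v) /\
  (sat (tinit (template_of P Q n)) v -> sat (tinit (template_of P Q k)) v).
Proof.
move=> n2 k2 sim v; split.
  rewrite !sat_ttrans // => -[w Pw Dw]; have [pi [pi1 pi2 pin pi_neq1 pres]] := sim w.
  exists (ren_val (reindex pi) w); first exact: sat_trans_reindex Pw.
  by move=> t; apply: template_abstracts_reindex (Dw t).
rewrite !sat_tinit // => -[w Pw Dw]; have [pi [pi1 pi2 pin pi_neq1 pres]] := sim w.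
exists (ren_val (reindex pi) w); first exact: sat_init_reindex Pw.
exact: template_abstracts_reindex Dw.
Qed.

(** * The maps between [n] threads and the bound *)

Let c := count_inter_thread Q.

Lemma count_inter_thread_gt0 i : inter_thread (Q i) -> 0 < c.
Proof. by move=> it; apply/card_gt0P; exists i; apply/asboolP. Qed.

(** If [c = 0], thread 2 is the one duplicated, which is harmless: [preserves] then demands
    nothing. *)
Lemma simulating_extend n w : 4 * c + 2 <= n ->
  simulating (4 * c + 2) n w (minn^~ (4 * c + 2)).
Proof.
set b := 4 * c + 2 => bn; have b2 : 2 <= b by rewrite /b leq_addl.
split.
- by apply/minn_idPl; apply: ltnW.
- exact/minn_idPl.
- by move=> p /andP[p1 _]; rewrite /threads /= geq_minr leq_min p1 ltnW.
- by move=> p _ p1; rewrite /minn; case: ltnP => // _ b1; rewrite b1 in b2.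
move=> t i e e12 /count_inter_thread_gt0 c0.
have b3 : 3 <= b by rewrite /b -[3]/(1 + 2) leq_add2r muln_gt0.
split=> h q /andP[q1 qn] qe.
  have := h q; rewrite (minn_idPl qn); apply=> //.
  by rewrite /threads /= q1 (leq_trans qn).
apply: h; first by rewrite /threads /= geq_minr leq_min q1 ltnW.
rewrite /minn; case: ltnP => // _ be.
by case: e12 => e12; rewrite be e12 in b3.
Qed.

Lemma simulating_restrict n w : 4 * c + 2 <= n ->
  exists pi, simulating n (4 * c + 2) w pi.
Proof.
move=> bn; have n2 : 2 <= n := leq_trans (leq_addl _ _) bn.
(* The first Boolean selects visible thread 2 rather than 1, the second the next state; together
   they give the factor 4. *)
pose J : finType := ({i : 'I_m | `[< inter_thread (Q i) >]} * (bool * bool))%type.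
have cardJ : #|J| = 4 * c.
  by rewrite card_prod card_sig card_prod card_bool mulnC.
pose bad (j : J) q := ~ sat (timed j.2.2
  (pair_inst (if j.2.1 then 2 else 1) q (Q (val j.1)))) w.
(* Falsifying threads are sought from 3 on only, as [pi] keeps 1 and 2. Thread 3 is the default; it
   exists because an element of [J] forces [c > 0]. *)
have /choice[wit witP] (j : J) : exists q, 3 <= q <= n /\
    ((exists2 q', 3 <= q' <= n & bad j q') -> bad j q).
  have [[q nq bq]|nb] := pselect (exists2 q', 3 <= q' <= n & bad j q').
    by exists q.
  exists 3; split=> //; rewrite leqnn /= (leq_trans _ bn) // -[3]/(1 + 2).
  rewrite leq_add2r muln_gt0 /=; apply: (@count_inter_thread_gt0 (val j.1)).
  exact/asboolP/(valP j.1).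
have lt_c p : 3 <= p <= 4 * c + 2 -> p - 3 < #|J|.
  by case/andP=> p3 pb; rewrite cardJ ltn_subLR // addSn ltnS addnC.
(* [pi] need not be injective: several indices may share a falsifying thread. *)
pose pi p := if insub (p - 3) is Some r then
  (if 3 <= p then wit (enum_val (r : 'I_#|J|)) else p) else p.
(* Truncated subtraction makes [p - 3] zero below 3 as well, hence the guard [3 <= p] in [pi]. *)
have pi_low p : p < 3 -> pi p = p.
  by rewrite /pi ltnNge; case: insub => // r /negPf ->.
have pi_high p : 3 <= p <= 4 * c + 2 -> exists j, pi p = wit j.
  move=> pb; exists (enum_val (Ordinal (lt_c _ pb))).
  have /andP[p3 _] := pb.
  by rewrite /pi (insubT (fun r => r < #|J|) (lt_c _ pb)) p3.
have pi_wit j : exists2 p, 3 <= p <= 4 * c + 2 & pi p = wit j.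
  exists (enum_rank j + 3).
    by rewrite leq_addl /= -cardJ -[3]/(1 + 2) addnA leq_add2r addn1.
  by rewrite /pi addnK leq_addl valK enum_rankK.
exists pi; split.
- exact: pi_low.
- exact: pi_low.
- move=> p /threads_split[->|->|/pi_high[j ->]]; rewrite /threads /=.
  + by rewrite pi_low //= ltnW.
  + by rewrite pi_low.
  + by have [/andP[q3 ->] _] := witP j; rewrite andbT ltnW // ltnW.
- move=> p /threads_split[->//|->|/pi_high[j ->]] _; first by rewrite pi_low.
  by have [/andP[q3 _] _] := witP j => q1; rewrite q1 in q3.
move=> t i e e12 it; split=> h q nq qe; last first.
  case/threads_split: nq qe => [->|->|/pi_high[j ->]] qe.
  + by rewrite pi_low //; apply: h => //; rewrite /threads /= ltnW.
  + by rewrite pi_low //; apply: h.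
  + have [/andP[q3 qn] _] := witP j; apply: h.
      by rewrite /threads /= qn andbT ltnW // ltnW.
    by move=> q1; rewrite q1 in q3; case: e12 => e1; rewrite e1 in q3.
(* Threads 1 and 2 are their own images. If a thread [q >= 3] falsified the predicate, the chosen
   witness would too, and it is the image of some [p >= 3], contradicting [h]. *)
case/threads_split: nq qe => [->|->|q3] qe.
- by rewrite -[1]pi_low //; apply: h => //; rewrite /threads /= addnC.
- by rewrite -[2]pi_low //; apply: h => //; rewrite /threads /= addnC.
have eE : e = (if e == 2 then 2 else 1) by case: e12 => ->.
apply: contrapT => bq.
pose j : J := (exist _ i (asboolT it), (e == 2, t)).
have [/andP[w3 wn] bw] := witP j.
have /bw : exists2 q', 3 <= q' <= n & bad j q' by exists q; rewrite // /bad /= -eE.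
have [p /andP[p3 pb] <-] := pi_wit j.
rewrite /bad /= -eE; apply; apply: h; first by rewrite /threads /= pb ltnW // ltnW.
by move=> pe; rewrite pe in p3; case: e12 => e1; rewrite e1 in p3.
Qed.

End Abstraction.

End Templates.

Theorem theorem3 (S L : Type) (DS : S -> Type) (DL : L -> Type)
  (P : program DS DL) (m : nat) (Q : 'I_m -> formula DS DL)
  (Q_over : forall i, predicate_over (Q i))
  (Q_class : forall i,
     shared_pred (Q i) \/ single_thread (Q i) \/ inter_thread (Q i)) :
  let b := 4 * count_inter_thread Q + 2 in
  forall n : nat, b <= n ->
    template_eq (template_of P Q n) (template_of P Q b).
Proof.
move=> b n bn; have b2 : 2 <= b by apply: leq_addl.
have n2 : 2 <= n := leq_trans b2 bn.
(* Going down, the map depends on the witness [w]; going up, one map serves all witnesses. *)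
have down := template_sub P Q_over Q_class n2 b2
  (fun w => simulating_restrict w bn).
have up := template_sub P Q_over Q_class b2 n2
  (fun w => ex_intro _ _ (simulating_extend w bn)).
by split=> v; have [? ?] := down v; have [? ?] := up v; split.
Qed.
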